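(* Let $0<p<1$ and $(p_0,p_1)=(p,1-p)$. For Lebesgue almost all parameters $\alpha\in[1,2]$ one has $M_\alpha<\infty$ and the random symmetric doubling map $R_\alpha$ has strong random matching with $M_c=M_\alpha+1$ for every critical point $c\in C$, and with $Y_c=\{S_\alpha^{M_\alpha}(1)\}$ for $c\in\{\frac12,\frac{1-\alpha}2\}$ and $Y_c=\{-S_\alpha^{M_\alpha}(1)\}$ for $c\in\{-\frac12,\frac{\alpha-1}2\}$. Moreover, for these $\alpha$, $R_\alpha$ does not satisfy the conditions of strong random matching with $M_c=K$ for all $c\in C$, for any positive integer $K<M_\alpha+1$.
   Context: Let $\Omega=\{0,1\}$ and $\alpha\in[1,2]$. Define $S_\alpha,T_{\alpha,0},T_{\alpha,1}:[-1,1]\to[-1,1]$ by $S_\alpha(x)=2x+\alpha$ if $-1\le x<-\frac12$, $2x$ if $-\frac12\le x\le\frac12$, $2x-\alpha$ if $\frac12<x\le1$; $T_{\alpha,0}(x)=2x+\alpha$ if $x\in[-1,\frac{1-\alpha}2]$, $2x$ if $x\in(\frac{1-\alpha}2,\frac12]$, $2x-\alpha$ if $x\in(\frac12,1]$; $T_{\alpha,1}(x)=2x+\alpha$ if $x\in[-1,-\frac12)$, $2x$ if $x\in[-\frac12,\frac{\alpha-1}2)$, $2x-\alpha$ if $x\in[\frac{\alpha-1}2,1]$. Write $T_j=T_{\alpha,j}$. The random symmetric doubling map is $R_\alpha:\Omega^{\mathbb N}\times[-1,1]\to\Omega^{\mathbb N}\times[-1,1]$, $R_\alpha(\omega,x)=(\sigma(\omega),T_{\omega_1}(x))$,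 with $\sigma$ the left shift; $T_j$ is chosen with probability $p_j$. Its set of critical points is $C=\{-\frac12,\frac{1-\alpha}2,\frac{\alpha-1}2,\frac12\}$. Put $$M_\alpha=\inf\{n\ge0:\tfrac12<S_\alpha^n(1)<\alpha-\tfrac12\}+1\in\mathbb N\cup\{\infty\}.$$ Notation. For $\mathbf u=u_1\cdots u_k\in\Omega^k$ let $T_{\mathbf u}=T_{u_k}\circ\cdots\circ T_{u_1}$ and $p_{\mathbf u}=p_{u_1}\cdots p_{u_k}$; for $\omega\in\Omega^{\mathbb N}$ let $T_\omega^k=T_{\omega_1\cdots\omega_k}$. For $c\in C$: $T_{\mathbf u}(c^-)=\lim_{x\uparrow c}T_{\mathbf u}(x)$, $T_{\mathbf u}(c^+)=\lim_{x\downarrow c}T_{\mathbf u}(x)$, and $T'_{\mathbf u}(c^\pm)$ are the corresponding one-sided limits of the derivative of $T_{\mathbf u}$ (here equal to $2^k$). Random matching. $R_\alpha$ has random matching if for every $c\in C$ there exist $M_c\in\mathbb N$ and a set $$Y_c\subseteq\{T_\omega^k(c^-):\omega\in\Omega^{\mathbb N},1\le k\le M_c\}\cap\{T_\omega^k(c^+):\omega\in\Omega^{\mathbb N},1\le k\le M_c\}$$ such that for every $\omega\in\Omega^{\mathbb N}$ there exist $1\le k_c(\omega),\ell_c(\omega)\le M_c$ with $T_\omega^{k_c(\omega)}(c^-)\in Y_c$ and $T_\omega^{\ell_c(\omega)}(c^+)\in Y_c$. Strong random matching. $R_\alpha$ has strong random matching if it has random matching and (for the choices of $M_c,Y_c,k_c,\ell_c$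 made there) for each $c\in C$ and $y\in Y_c$, $$\sum_{\mathbf u\in\Omega(y)^-}\frac{p_{\mathbf u}}{T_{\mathbf u}'(c^-)}=\sum_{\mathbf u\in\Omega(y)^+}\frac{p_{\mathbf u}}{T_{\mathbf u}'(c^+)},$$ where $\Omega(y)^-$ is the set of $\mathbf u\in\bigcup_{k=1}^{M_c}\Omega^k$ such that $\mathbf u=\omega_1\cdots\omega_{k_c(\omega)}$ for some $\omega\in\Omega^{\mathbb N}$ and $T_{\mathbf u}(c^-)=y$, and $\Omega(y)^+$ is the set of $\mathbf u\in\bigcup_{k=1}^{M_c}\Omega^k$ such that $\mathbf u=\omega_1\cdots\omega_{\ell_c(\omega)}$ for some $\omega\in\Omega^{\mathbb N}$ and $T_{\mathbf u}(c^+)=y$.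
   Formalization: Strong random matching here also requires k_c(ω), ℓ_c(ω) to depend only on the blocks ω_1…ω_{k_c(ω)}, ω_1…ω_{ℓ_c(ω)}; with arbitrary choices the ''Moreover'' part is false, e.g. for p=1/2, 1<α<3/2, K=2, where a word and its own prefix may both be counted. *)

(* Defs.v *)
From HB Require Import structures.
From mathcomp Require Import all_boot all_order all_algebra.
From mathcomp Require Import all_classical all_reals all_analysis.

Set Implicit Arguments.
Unset Strict Implicit.
Unset Printing Implicit Defensive.

Import Order.TTheory GRing.Theory Num.Theory.
Import numFieldNormedType.Exports.

Local Open Scope classical_set_scope.
Local Open Scope ring_scope.

(* The alphabet {0,1} is bool (0 = false, 1 = true).  A sequence omega in
   {0,1}^N is a function nat -> bool with omega_1 = w 0, and finite words are
   of type seq bool. *)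

Section RandomMatching.
Variable R : realType.
Variables (T : bool -> R -> R) (p : bool -> R).

Definition block (w : nat -> bool) (k : nat) : seq bool := mkseq w k.

(* The first letter of u is applied first. *)
Definition Tword (u : seq bool) (x : R) : R :=
  foldl (fun y j => T j y) x u.

Definition pword (u : seq bool) : R := \prod_(j <- u) p j.

(* One-sided limits: F is the filter c^'- or c^'+. *)
Definition Tlim (u : seq bool) (F : set_system R) : R :=
  lim (Tword u x @[x --> F]).

Definition dTlim (u : seq bool) (F : set_system R) : R :=
  lim (derive1 (Tword u) x @[x --> F]).

Definition orbit_set (M : nat) (F : set_system R) : set R :=
  [set y | exists (w : nat -> bool) (k : nat),
     (1 <= k <= M)%N /\ y = Tlim (block w k) F].

Definition random_matching_at (c : R) (M : nat) (Y : set R)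
    (k l : (nat -> bool) -> nat) : Prop :=
  Y `<=` orbit_set M c^'- `&` orbit_set M c^'+ /\
  forall w : nat -> bool,
    [/\ (1 <= k w <= M)%N, (1 <= l w <= M)%N,
        Y (Tlim (block w (k w)) c^'-) & Y (Tlim (block w (l w)) c^'+)].

(* k(omega) depends only on the block omega_1 ... omega_(k(omega)), as for the
   first time at which the orbit enters Y.  Hence no word
   omega_1 ... omega_(k(omega)) is a proper prefix of another one, and these
   words index a partition of {0,1}^N into cylinders. *)
Definition block_determined (k : (nat -> bool) -> nat) : Prop :=
  forall w w' : nat -> bool, block w' (k w) = block w (k w) -> k w' = k w.

(* Omega(y)^- for F = c^'-, t = k_c, and Omega(y)^+ for F = c^'+, t = l_c. *)
Definition matching_words (M : nat) (t : (nat -> bool) -> nat)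
    (F : set_system R) (y : R) : set (seq bool) :=
  [set u | [/\ (1 <= size u <= M)%N,
               exists w : nat -> bool, u = block w (t w) & Tlim u F = y]].

Definition strong_random_matching_at (c : R) (M : nat) (Y : set R)
    (k l : (nat -> bool) -> nat) : Prop :=
  [/\ random_matching_at c M Y k l,
      block_determined k, block_determined l &
      forall y, Y y ->
        \sum_(u \in matching_words M k c^'- y) (pword u / dTlim u c^'-) =
        \sum_(u \in matching_words M l c^'+ y) (pword u / dTlim u c^'+)].

Definition strong_random_matching_with (C : set R) (M : R -> nat)
    (Y : R -> set R) : Prop :=
  forall c, C c ->
    exists k l : (nat -> bool) -> nat,
      strong_random_matching_at c (M c) (Y c) k l.

End RandomMatching.

Section SymmetricDoubling.
Variable R : realType.
Implicit Types (a x : R) (j : bool).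

(* The interval [-1,1] is invariant under the maps below for a in [1,2]; the
   formulas are extended to the whole line, but their values outside [-1,1]
   play no role. *)
Definition Sdoubling a x : R :=
  if x < - 2^-1 then 2 * x + a
  else if x <= 2^-1 then 2 * x
  else 2 * x - a.

Definition Tdoubling a j x : R :=
  if j then
    if x < - 2^-1 then 2 * x + a
    else if x < (a - 1) / 2 then 2 * x
    else 2 * x - a
  else
    if x <= (1 - a) / 2 then 2 * x + a
    else if x <= 2^-1 then 2 * x
    else 2 * x - a.

Definition critical a : set R :=
  [set c | c \in [:: - 2^-1; (1 - a) / 2; (a - 1) / 2; 2^-1]].

Definition bernoulli_weight (p : R) j : R := if j then 1 - p else p.

Definition entrance_times a : set nat :=
  [set n | 2^-1 < iter n (Sdoubling a) 1 < a - 2^-1].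

Definition matching_time a : \bar R :=
  (ereal_inf [set n%:R%:E | n in entrance_times a] + 1)%E.

(* The two cases overlap only for a = 1 and a = 2. *)
Definition matching_set a (M : nat) (c : R) : set R :=
  if c \in [:: 2^-1; (1 - a) / 2] then [set iter M (Sdoubling a) 1]
  else [set - iter M (Sdoubling a) 1].

End SymmetricDoubling.

(* Main.v *)
Require Import Defs.
From HB Require Import structures.
From mathcomp Require Import all_boot all_order all_algebra.
From mathcomp Require Import all_classical all_reals all_analysis.
From mathcomp Require Import ring lra zify.

(** Write x_n = S^n(1).  For irrational a, until the orbit of 1 enters the gap
    ]1/2, a - 1/2[, both one-sided random orbits of each critical point are,
    after n + 1 steps and up to a global sign, at x_n or x_n - a, and from the
    gap both of these points are sent to the same place.  This gives matching
    with a constant stopping time.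

    No earlier matching is possible: x_n and x_n - a for different n are all
    distinct, so an equality of weighted sums over matching words would identify
    the probabilities, for the orbits of 1/2^- and 1/2^+, of being at x_N rather
    than x_N - a at the entrance time N.  These differ, because the two states
    are never exchanged.

    If the gap is never entered then x_n = 2^n - k_n a stays in [a - 1, 1], and
    the digits of k_n in base B = 2^(m+1) avoid B/2 once 2^m (a - 1) > 1.  So a
    lies in one of (B-1)^J intervals of length of order B^-J. *)

Set Implicit Arguments.
Unset Strict Implicit.
Unset Printing Implicit Defensive.

Import Order.TTheory GRing.Theory Num.Theory.
Import numFieldNormedType.Exports.

Local Open Scope classical_set_scope.
Local Open Scope ring_scope.

(** * Finite words and optional stopping *)

Section StoppedWords.

Fixpoint words_upto (m : nat) : seq (seq bool) :=
  if m is m'.+1 then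
    [::] :: map (cons true) (words_upto m') ++ map (cons false) (words_upto m')
  else [:: [::]].

Lemma mem_words_upto m u : (u \in words_upto m) = (size u <= m)%N.
Proof.
elim: m u => [|m IH] [|j u] //=.
rewrite in_cons /= mem_cat ltnS -IH.
have inj (b : bool) : injective (cons b) by move=> ? ? [].
case: j.
  rewrite (mem_map (inj _)); case: (u \in _) => //=.
  by apply/negbTE/negP => /mapP[? _].
rewrite (mem_map (inj _)) orbC; case: (u \in _) => //=.
by apply/negbTE/negP => /mapP[? _].
Qed.

Lemma words_upto_uniq m : uniq (words_upto m).
Proof.
have inj (b : bool) : injective (cons b) by move=> ? ? [].
elim: m => //= m IH; rewrite cat_uniq !map_inj_uniq// IH /= andbT.
rewrite mem_cat negb_or -!andbA; apply/and3P; split.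
- by apply/negP => /mapP[? _].
- by apply/negP => /mapP[? _].
- by apply/hasPn => _ /mapP[u _ ->]; apply/negP => /mapP[? _].
Qed.

Lemma take_block w m n : (m <= n)%N -> take m (block w n) = block w m.
Proof. by move=> mn; rewrite /block /mkseq -map_take take_iota (minn_idPl mn). Qed.

Definition stopped_word (t : (nat -> bool) -> nat) (u : seq bool) : bool :=
  `[< exists w, u = block w (t w) >].

Lemma stopped_word_prefix t u v : block_determined t ->
  stopped_word t u -> stopped_word t (u ++ v) -> v = [::].
Proof.
move=> tP /asboolP[w uE] /asboolP[w' uvE].
have sz : size u = t w by rewrite uE size_mkseq.
have sz' : (size u + size v)%N = t w' by rewrite -size_cat uvE size_mkseq.
have /tP : block w' (t w) = block w (t w).
  rewrite -[RHS]uE -(take_size_cat v (erefl (size u))) uvE sz.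
  by rewrite take_block// -sz' -sz leq_addr.
by rewrite -sz -sz'; case: v {uvE sz'} => //= j v /eqP;
  rewrite -[X in _ == X]addn0 eqn_add2l.
Qed.

(* The words at which a bounded stopping time stops form a maximal prefix code,
   and the hypothesis on [H] says that it is a finitely additive measure on
   cylinders: this is optional stopping. *)
Lemma sum_stopped_words (V : zmodType) (t : (nat -> bool) -> nat) (K : nat)
    (H : seq bool -> V) :
  block_determined t -> (forall w, (t w <= K)%N) ->
  (forall u, (size u < K)%N -> H u = H (rcons u true) + H (rcons u false)) ->
  \sum_(u <- words_upto K | stopped_word t u) H u = H [::].
Proof.
move=> tP tK Hadd.
(* Induction on the number [m] of letters still available, for a word [u] none of whose proper
   prefixes is a stopped word. *)
suff main m u : (size u + m)%N = K ->
    (forall n, (n < size u)%N -> ~~ stopped_word t (take n u)) ->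
    \sum_(v <- words_upto m | stopped_word t (u ++ v)) H (u ++ v) = H u.
  exact: (main K [::]).
elim: m u => [|m IH] u szu nst.
  rewrite /= big_cons big_nil cats0 addr0; case: ifPn => // /negP nstu; exfalso.
  (* At full length, the extension of [u] by [false] stops at a time at most [K = size u], so some
     prefix of [u] is a stopped word, and it can only be [u]. *)
  have st : stopped_word t (take (t (nth false u)) u).
    apply/asboolP; exists (nth false u).
    rewrite -{2}(mkseq_nth false u) -/(block _ _) take_block//.
    by rewrite -[size u]addn0 szu.
  have := tK (nth false u); rewrite -szu addn0 leq_eqVlt => /orP[/eqP e|lt].
    by apply: nstu; move: st; rewrite e take_size.
  by move: (nst _ lt); rewrite st.
rewrite /= big_cons cats0; case: ifPn => stu.
  rewrite big_cat !big_map /= !big_pred0 ?addr0// => v;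
    by apply/negP => /(stopped_word_prefix tP stu).
rewrite big_cat !big_map /= Hadd -?szu ?addnS ?ltnS ?leq_addr//.
have IHj j : \sum_(v <- words_upto m | stopped_word t (u ++ j :: v)) H (u ++ j :: v)
    = H (rcons u j).
  rewrite -(IH (rcons u j)).
  - by apply: eq_big => [v|v _]; rewrite cat_rcons.
  - by rewrite size_rcons addSn -addnS.
  move=> n; rewrite size_rcons ltnS leq_eqVlt => /orP[/eqP ->|lt].
    by rewrite -cats1 take_size_cat.
  by rewrite -cats1 takel_cat 1?ltnW//; exact: nst.
by rewrite !IHj.
Qed.

End StoppedWords.

(** * The orbit of 1 before the gap and the two states of the random orbits *)

Section Orbit.
Variables (R : realType) (a : R).

Local Notation x n := (iter n (Sdoubling a) 1).

Lemma entrance_timesE n : entrance_times a n = (2^-1 < x n < a - 2^-1).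
Proof. by []. Qed.

(** The upper branch gives [2 * y - a], which is at least [a - 1] exactly when [y] is at least
    [a - 1/2]; the gap is what lies between 1/2 and this bound. *)
Lemma orbit_bounds n : 1 <= a <= 2 ->
  (forall i, (i < n)%N -> ~ entrance_times a i) -> a - 1 <= x n <= 1.
Proof.
move=> a12; elim: n => [|n IH] nogap; first by rewrite /=; lra.
have /IH : forall i, (i < n)%N -> ~ entrance_times a i.
  by move=> i /ltnW; exact: nogap.
have := nogap n (ltnSn n); rewrite entrance_timesE /= /Sdoubling.
set y := iter _ _ _ => gap yb.
have [lt|_] := ltP y (- 2^-1); first lra.
have [le|gt] := leP y (2^-1); first lra.
have [lt|ge] := ltP y (a - 2^-1); last lra.
by exfalso; apply: gap; rewrite gt lt.
Qed.

(* As long as the orbit has not entered the gap, this is the integer part of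
   [2 ^ n / a]. *)
Fixpoint orbit_quotient (n : nat) : nat :=
  if n is n'.+1 then ((orbit_quotient n').*2 + ((2^-1 : R) < x n')%R)%N else 0%N.

Lemma orbit_quotientE n : 1 <= a <= 2 ->
  (forall i, (i < n)%N -> ~ entrance_times a i) ->
  x n = 2 ^+ n - (orbit_quotient n)%:R * a.
Proof.
move=> a12; elim: n => [|n IH] nogap; first by rewrite expr0 mul0r subr0.
have nogap' : forall i, (i < n)%N -> ~ entrance_times a i.
  by move=> i /ltnW; exact: nogap.
have /(_ a12) := orbit_bounds _ nogap'.
rewrite /= natrD -muln2 natrM exprS {}IH// /Sdoubling.
set y := 2 ^+ n - _ => yb.
have [lt|_] := ltP y (- 2^-1); first lra.
by have [le|gt] := leP y (2^-1); rewrite /= /y; ring.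
Qed.

(* Before matching, every random orbit issued from a side of [1/2] or
   [(1 - a) / 2] is, after n + 1 steps, at [x n] or at [x n - a]. *)
Definition orbit_state (n : nat) (s : bool) : R := x n - (if s then 0 else a).

(** The letter matters for only one of the two states, which letter 0 sends to [true] and letter 1
    to [false]; the other state is kept. The states are thus never exchanged. *)
Definition state_step (n : nat) (s j : bool) : bool :=
  if 2^-1 < x n then s || ~~ j else s && ~~ j.

Fixpoint state_run (n : nat) (s : bool) (u : seq bool) : bool :=
  if u is j :: u' then state_run n.+1 (state_step n s j) u' else s.

Lemma state_run_rcons n s u j :
  state_run n s (rcons u j) = state_step (n + size u) (state_run n s u) j.
Proof.
by elim: u n s => [|i u IH] n s /=; rewrite ?addn0// IH addSnnS.
Qed.

Lemma irrational_mul_int (i : int) (q : rat) :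
  irrational a -> i%:~R * a = ratr q -> i = 0.
Proof.
move=> irr e; apply/eqP; apply: contraT => i0; exfalso; apply: irr.
rewrite /rational /=; exists (q / i%:~R) => //.
by rewrite fmorph_div /= ratr_int -e mulrC mulKf// intr_eq0.
Qed.

(** Both sides are a power of 2 minus an integer multiple of [a], and irrationality separates the
    two terms. *)
Lemma orbit_state_inj n m s t : 1 <= a <= 2 -> irrational a ->
  (forall i, (i < n)%N -> ~ entrance_times a i) ->
  (forall i, (i < m)%N -> ~ entrance_times a i) ->
  orbit_state n s = orbit_state m t -> n = m /\ s = t.
Proof.
move=> a12 irr nn nm e.
have st k b : (forall i, (i < k)%N -> ~ entrance_times a i) -> orbit_state k b =
    2 ^+ k - ((orbit_quotient k + ~~ b)%N%:Z)%:~R * a.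
  move=> nk; rewrite /orbit_state orbit_quotientE//.
  by rewrite -pmulrn natrD; case: b => /=; ring.
have nme : n = m.
  move: e; rewrite !st//; set i := Posz _; set j := Posz _ => e.
  have ij : (i - j)%:~R * a = ratr (2 ^+ n - 2 ^+ m).
    by rewrite [RHS]rmorphB /= !rmorphXn /= ratr_nat intrB mulrBl; lra.
  have /subr0_eq ji := irrational_mul_int irr ij.
  by move: e; rewrite ji => /addIr; apply: ieexprIn => //; lra.
split=> //; move: e; rewrite nme /orbit_state => /addrI/oppr_inj.
by case: s; case: t => //; move: a12; lra.
Qed.

Lemma orbit_neq n : 1 <= a <= 2 -> irrational a ->
  (forall i, (i < n)%N -> ~ entrance_times a i) ->
  x n != 2^-1 /\ x n != a - 2^-1.
Proof.
move=> a12 irr nn; rewrite orbit_quotientE//; set k := orbit_quotient n.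
have half : (2^-1 : R) = ratr 2^-1 by rewrite fmorphV /= ratr_nat.
have pow m : (2 ^+ m : R) = ratr (2 ^+ m) by rewrite rmorphXn /= ratr_nat.
split; apply/eqP => e.
  have /(irrational_mul_int irr) k0 : k%:Z%:~R * a = ratr (2 ^+ n - 2^-1).
    by rewrite rmorphB /= -half -pow -pmulrn -e; ring.
  move: e; have -> : k = 0%N by case: k0.
  by have := exprn_ege1 n (ler1n R 2); rewrite mul0r; lra.
have /(irrational_mul_int irr) : (k.+1)%:Z%:~R * a = ratr (2 ^+ n + 2^-1).
  rewrite rmorphD /= -half -pow -pmulrn -natr1.
  by have -> : 2^-1 = a - (2 ^+ n - k%:R * a); [rewrite e; ring|ring].
by [].
Qed.

Lemma Tdoubling_orbit_state n s j : 1 < a < 2 -> irrational a ->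
  (forall i, (i <= n)%N -> ~ entrance_times a i) ->
  Tdoubling a j (orbit_state n s) = orbit_state n.+1 (state_step n s j) /\
  ~ critical a (orbit_state n s).
Proof.
move=> a12 irr nn.
have a12' : 1 <= a <= 2 by lra.
have nn' i : (i < n)%N -> ~ entrance_times a i by move=> /ltnW; exact: nn.
have := orbit_bounds a12' nn'; have [] := orbit_neq a12' irr nn'.
have := nn n (leqnn n); rewrite entrance_timesE /critical /state_step /orbit_state /= !inE.
set y := iter _ _ _ => /negP; rewrite negb_and -!leNgt => gap y1 y2 yb.
(* Strictness, due to [orbit_neq], excludes the critical values 1/2 for [y] and -1/2 for [y - a]. *)
have {gap} [lt|gt] : y < 2^-1 \/ a - 2^-1 < y.
  by case/orP: gap => h; [left|right]; rewrite lt_neqAle h andbT// eq_sym.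
  rewrite /Sdoubling /Tdoubling (ltNge _ y) (ltW lt) /=.
  have -> : (y < - 2^-1) = false by apply/negbTE; rewrite -leNgt; lra.
  split; last first.
    by case: s => /or4P[]/eqP; lra.
  by case: s; case: j => /=; do 2?[case: ltP => ? //=|case: leP => ? //=]; lra.
have y12 : 2^-1 < y by lra.
rewrite /Sdoubling /Tdoubling (leNgt y) y12 /=.
have -> : (y < - 2^-1) = false by apply/negbTE; rewrite -leNgt; lra.
split; last first.
  by case: s => /or4P[]/eqP; lra.
by case: s; case: j => /=; do 2?[case: ltP => ? //=|case: leP => ? //=]; lra.
Qed.

(** In the gap [y] exceeds 1/2 and [y - a] is below -1/2, so under either letter the outer branches
    apply, and both give [2 * y - a]. *)
Lemma Tdoubling_gap n s j : 1 < a < 2 -> entrance_times a n ->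
  Tdoubling a j (orbit_state n s) = x n.+1 /\
  ~ critical a (orbit_state n s).
Proof.
move=> a12; rewrite entrance_timesE /critical /orbit_state /= !inE.
set y := iter _ _ _ => gap; have /andP[y12 _] := gap.
rewrite /Sdoubling /Tdoubling (leNgt y) y12 /=.
have -> : (y < - 2^-1) = false by apply/negbTE; rewrite -leNgt; lra.
split; last first.
  by case: s => /or4P[]/eqP; lra.
by case: s; case: j => /=; do 2?[case: ltP => ? //=|case: leP => ? //=]; lra.
Qed.

End Orbit.

(** * One-sided affine germs of the random compositions *)

Section Germ.
Variables (R : realType) (a : R) (c : R) (F : set_system R).
Context {FP : ProperFilter F}.
Hypothesis Fc : F --> c.
(** This allows an identity that holds along [F] to be differentiated there. *)
Hypothesis F_open : forall P : set R, F P -> \forall x \near F, \near x, P x.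

Definition germ (u : seq bool) (v : R) : Prop :=
  \forall x \near F, Tword (Tdoubling a) u x = v + 2 ^+ size u * (x - c).

Lemma Tword_rcons (T : bool -> R -> R) u j x :
  Tword T (rcons u j) x = T j (Tword T u x).
Proof. by rewrite /Tword -cats1 foldl_cat. Qed.

(** Off the critical points every comparison in [Tdoubling] is locally constant, so a single branch
    applies. *)
Lemma Tdoubling_near j y : ~ critical a y ->
  \forall x \near y, Tdoubling a j x = Tdoubling a j y + 2 * (x - y).
Proof.
rewrite /critical /= !inE => /negP; rewrite !negb_or => /and4P[c1 c2 c3 c4].
have side b : y != b -> \forall x \near y, (x < b) = (y < b) /\ (x <= b) = (y <= b).
  rewrite neq_lt => /orP[lt|gt].
    near=> x; have xb : x < b by near: x; exact: lt_nbhsl.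
    by rewrite xb lt (ltW xb) (ltW lt).
  near=> x; have xb : b < x by near: x; exact: lt_nbhsr.
  by rewrite !leNgt xb gt /= !ltNge (ltW xb) (ltW gt).
near=> x.
have [e1 f1] : (x < - 2^-1) = (y < - 2^-1) /\ (x <= - 2^-1) = (y <= - 2^-1).
  by near: x; exact: side.
have [e2 f2] : (x < (1 - a) / 2) = (y < (1 - a) / 2) /\
    (x <= (1 - a) / 2) = (y <= (1 - a) / 2) by near: x; exact: side.
have [e3 f3] : (x < (a - 1) / 2) = (y < (a - 1) / 2) /\
    (x <= (a - 1) / 2) = (y <= (a - 1) / 2) by near: x; exact: side.
have [e4 f4] : (x < 2^-1) = (y < 2^-1) /\ (x <= 2^-1) = (y <= 2^-1).
  by near: x; exact: side.
rewrite /Tdoubling e1 e3 f2 f4.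
by case: j; do ![case: ifP => _]; ring.
Unshelve. all: by end_near.
Qed.

Lemma cvg_affine (v k : R) : v + k * (x - c) @[x --> F] --> v.
Proof.
rewrite -[X in _ --> X]addr0 -[X in _ + X](mulr0 k) -(subrr c).
apply: cvgD; first exact: cvg_cst.
by apply: cvgM; [exact: cvg_cst|apply: cvgB => //; exact: cvg_cst].
Qed.

Lemma germ_rcons u v j : germ u v -> ~ critical a v ->
  germ (rcons u j) (Tdoubling a j v).
Proof.
move=> gu /(Tdoubling_near j) nv.
move: (@cvg_affine v (2 ^+ size u)) => /(_ _ nv) {}nv; rewrite /germ.
have {}nv : \forall x \near F, Tdoubling a j (v + 2 ^+ size u * (x - c)) =
    Tdoubling a j v + 2 * (v + 2 ^+ size u * (x - c) - v) by exact: nv.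
near=> x.
rewrite Tword_rcons size_rcons exprS.
have -> : Tword (Tdoubling a) u x = v + 2 ^+ size u * (x - c) by near: x.
rewrite (near nv x)//; ring.
Unshelve. all: by end_near.
Qed.

Lemma germ_Tlim u v : germ u v -> Tlim (Tdoubling a) u F = v.
Proof.
move=> gu; rewrite /Tlim; apply: cvg_lim => //.
apply: cvg_trans (@cvg_affine v (2 ^+ size u)); apply: near_eq_cvg; near=> x.
by apply/esym; near: x.
Unshelve. all: by end_near.
Qed.

Lemma germ_dTlim u v : germ u v -> dTlim (Tdoubling a) u F = 2 ^+ size u.
Proof.
move=> gu; rewrite /dTlim; apply: cvg_lim => //.
apply: (@cvg_trans _ ((fun=> 2 ^+ size u) @ F)); last exact: cvg_cst.
apply: near_eq_cvg; near=> x.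
have gx : \near x, Tword (Tdoubling a) u x = v + 2 ^+ size u * (x - c).
  by near: x; exact: F_open.
rewrite derive1E (near_eq_derive _ gx).
by rewrite derive_val add0r mul1r subr0 /GRing.scale /= mulr1.
Unshelve. all: by end_near.
Qed.

End Germ.

(** * The first step at a critical point and the reflection symmetry *)

Section FirstStep.
Variables (R : realType) (a : R).

Definition side (left : bool) (c : R) : set_system R := if left then c^'- else c^'+.

#[global] Instance side_proper left c : ProperFilter (side left c).
Proof. by case: left; rewrite /side; exact: _. Qed.

Lemma side_open left (c : R) (P : set R) : (\forall x \near side left c, P x) ->
  \forall x \near side left c, \near x, P x.
Proof.
case: left; rewrite /side ?/at_left ?/at_right => /near_join;
  apply: filterS => x nP xc; near=> y; apply: (near nP y) => //; near: y.
  exact: lt_nbhsl.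
exact: lt_nbhsr.
Unshelve. all: by end_near.
Qed.

Lemma cvg_side left (c : R) : side left c --> c.
Proof. by case: left; exact: cvg_within. Qed.

Lemma TdoublingN j (x : R) : 1 < a < 2 ->
  Tdoubling a j (- x) = - Tdoubling a (~~ j) x.
Proof.
move=> a12; rewrite /Tdoubling; case: j => /=;
  do ![case: ltP => ? //=|case: leP => ? //=]; lra.
Qed.

(* [flip = true] marks the points -1/2 and (a-1)/2, whose orbits are the
   reflections of those of 1/2 and (1-a)/2. *)
Definition flipped (flip : bool) (x : R) : R := if flip then - x else x.

(** At an unflipped point only the left side under letter 0 starts at 1; the other three cases start
    at [1 - a]. Reflection exchanges both the sides and the letters. *)
Definition first_state (left flip j : bool) : bool :=
  (left != flip) && (j == flip).

(** Neighbouring critical points are [a - 1] or [(2 - a) / 2] apart; these smaller radii keep [x] on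
    one branch. *)
Definition near_side (c : R) left (x : R) : Prop :=
  if left then [/\ c - (a - 1) / 4 < x, c - (2 - a) / 4 < x & x < c]
  else [/\ c < x, x < c + (a - 1) / 4 & x < c + (2 - a) / 4].

Lemma Tdoubling_near_half (x : R) left j : 1 < a < 2 -> near_side 2^-1 left x ->
  Tdoubling a j x = orbit_state a 0 (first_state left false j) + 2 * (x - 2^-1).
Proof.
rewrite /near_side /orbit_state /Tdoubling /= => a12.
by case: left => /= -[x1 x2 x3]; case: j => /=;
  do ?[case: ltP => ? //=|case: leP => ? //=]; lra.
Qed.

Lemma Tdoubling_near_fold (x : R) left j : 1 < a < 2 ->
  near_side ((1 - a) / 2) left x ->
  Tdoubling a j x =
    orbit_state a 0 (first_state left false j) + 2 * (x - (1 - a) / 2).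
Proof.
rewrite /near_side /orbit_state /Tdoubling /= => a12.
by case: left => /= -[x1 x2 x3]; case: j => /=;
  do ?[case: ltP => ? //=|case: leP => ? //=]; lra.
Qed.

Lemma near_sideN c left x : near_side c left x -> near_side (- c) (~~ left) (- x).
Proof. by rewrite /near_side; case: left => -[]/= ? ? ?; split; lra. Qed.

Lemma first_stateN left j : first_state (~~ left) false (~~ j) = first_state left true j.
Proof. by case: left; case: j. Qed.

Lemma Tdoubling_near_critical (c x : R) left j : 1 < a < 2 -> critical a c ->
  near_side c left x ->
  let flip := c \notin [:: 2^-1; (1 - a) / 2] in
  Tdoubling a j x =
    flipped flip (orbit_state a 0 (first_state left flip j)) + 2 * (x - c).
Proof.
rewrite /critical /= !inE /flipped => a12 cc xe.
have {cc} [] : [\/ c = - 2^-1, c = (1 - a) / 2, c = (a - 1) / 2 | c = 2^-1].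
  by case/or4P: cc => /eqP; [constructor 1|constructor 2|constructor 3|constructor 4].
- move=> cE; have -> : (c == 2^-1) = false by apply/eqP; lra.
  have -> : (c == (1 - a) / 2) = false by apply/eqP; lra.
  move: xe => /near_sideN; rewrite cE opprK => /(Tdoubling_near_half (~~ j) a12).
  by rewrite TdoublingN// negbK first_stateN => e /=; lra.
- by move=> cE; rewrite cE eqxx orbT; apply: Tdoubling_near_fold => //; rewrite -cE.
- move=> cE; have -> : (c == 2^-1) = false by apply/eqP; lra.
  have -> : (c == (1 - a) / 2) = false by apply/eqP; lra.
  have cN : - c = (1 - a) / 2 by lra.
  move: xe => /near_sideN; rewrite cN => /(Tdoubling_near_fold (~~ j) a12).
  by rewrite TdoublingN// negbK first_stateN => e /=; lra.
- by move=> cE; rewrite cE eqxx; apply: Tdoubling_near_half => //; rewrite -cE.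
Qed.

Lemma germ_first (c : R) left j : 1 < a < 2 -> critical a c ->
  let flip := c \notin [:: 2^-1; (1 - a) / 2] in
  germ a c (side left c) [:: j]
    (flipped flip (orbit_state a 0 (first_state left flip j))).
Proof.
move=> a12 cc flip; rewrite /germ /=.
have d1 : 0 < (a - 1) / 4 by lra.
have d2 : 0 < (2 - a) / 4 by lra.
have : \forall x \near side left c, near_side c left x.
  rewrite /side /near_side; case: left; near=> x; split; near: x.
  - by apply: nbhs_left_gt; lra.
  - by apply: nbhs_left_gt; lra.
  - exact: nbhs_left_lt.
  - exact: nbhs_right_gt.
  - by apply: nbhs_right_lt; lra.
  - by apply: nbhs_right_lt; lra.
by apply: filterS => x xc; rewrite expr1; exact: Tdoubling_near_critical.
Unshelve. all: by end_near.
Qed.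

End FirstStep.

(** * Covering the parameters without matching by short intervals *)

Section Null.
Variable R : realType.
Local Notation x a n := (iter n (@Sdoubling R a) 1).
Local Notation mu := (@lebesgue_measure R).

Definition never_matching (a : R) : Prop := forall n, ~ entrance_times a n.

(* A digit B/2 = 10...0 would mean that the orbit leaves [1/2, 1] for a point
   at least a - 1 and is then doubled m times without exceeding 1/2. *)
Lemma orbit_quotient_digit (a : R) m n : 1 <= a <= 2 -> 1 < 2 ^+ m * (a - 1) ->
  never_matching a ->
  exists d, [/\ (d < 2 ^ m.+1)%N, d != (2 ^ m)%N &
    orbit_quotient a (n + m.+1) = (2 ^ m.+1 * orbit_quotient a n + d)%N].
Proof.
move=> a12 am na.
have ob i : a - 1 <= x a i <= 1 by apply: orbit_bounds.
have step i : x a i.+1 = 2 * x a i - (2^-1 < x a i)%R%:R * a.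
  have := ob i; rewrite /= /Sdoubling; set y := iter _ _ _ => yb.
  rewrite ifF; last by apply/negbTE; rewrite -leNgt; lra.
  by case: leP => _ /=; ring.
(* The digit [2 ^ k] on [k.+1] bits is one subtraction of [a] followed by [k] pure doublings, which
   multiply the bound [a - 1] by [2 ^+ k]; at [k = m] the result exceeds 1. *)
suff main k : (k <= m)%N -> exists d, [/\ (d < 2 ^ k.+1)%N,
    orbit_quotient a (n + k.+1) = (2 ^ k.+1 * orbit_quotient a n + d)%N &
    d = (2 ^ k)%N -> 2 ^+ k * (a - 1) <= x a (n + k.+1)].
  have [d [dlt de dh]] := main m (leqnn m); exists d; split => //.
  by apply/eqP => /dh; have := ob (n + m.+1)%N; lra.
elim: k => [_|k IH km].
  exists (2^-1 < x a n)%R; rewrite addn1 /= mul2n; split => //.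
    by case: (_ < _).
  rewrite expr0 mul1r => _; have := ob n.+1; rewrite /=; lra.
have [d [dlt de dh]] := IH (ltnW km).
exists (d.*2 + ((2^-1 : R) < x a (n + k.+1)%N)%R)%N; split.
- by rewrite expnS; case: (_ < _); lia.
- by rewrite addnS /= de [in RHS]expnS; case: (_ < _) => /=; lia.
rewrite expnS => e.
have [b0 dk] : (2^-1 < x a (n + k.+1)%N) = false /\ d = (2 ^ k)%N.
  by move: e; case: (_ < _) => /= e; split => //; lia.
have := step (n + k.+1)%N; rewrite b0 mul0r subr0 -addnS => ->.
by have := dh dk; rewrite exprS; lra.
Qed.

Fixpoint digit_numbers (m J : nat) : seq nat :=
  if J is J'.+1 then
    [seq (2 ^ m.+1 * k + d)%N | k <- digit_numbers m J',
       d <- rem (2 ^ m)%N (iota 0 (2 ^ m.+1))]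
  else [:: 0%N].

Lemma size_digit_numbers m J : size (digit_numbers m J) = ((2 ^ m.+1).-1 ^ J)%N.
Proof.
elim: J => [//|J IH]; rewrite /= size_allpairs IH size_rem ?size_iota ?expnSr//.
by rewrite mem_iota leq0n add0n muln2 -addnn -[X in (X < _)%N]addn0 ltn_add2l expn_gt0.
Qed.

Lemma orbit_quotient_digits (a : R) m J : 1 <= a <= 2 -> 1 < 2 ^+ m * (a - 1) ->
  never_matching a -> orbit_quotient a (J * m.+1) \in digit_numbers m J.
Proof.
move=> a12 am na; elim: J => [|J IH]; first by rewrite mul0n inE.
have [d [dlt d2 e]] := orbit_quotient_digit (J * m.+1) a12 am na.
rewrite mulSn addnC e; apply/allpairsP; exists (orbit_quotient a (J * m.+1), d).
split=> //=; rewrite mem_rem_uniq ?iota_uniq// !inE d2 /= mem_iota//.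
Qed.

Definition parameter_itv (n k : nat) : set R :=
  `[(2 ^+ n - 1) / k%:R, (2 ^+ n - 1) / k%:R + 4 / 2 ^+ n].

(** The bounds on [x a n] give [2 ^+ n - 1 <= k * a <= 2 ^+ n]. With [a <= 2] this forces
    [k >= 2 ^+ n / 4], hence an interval length independent of [k]. *)
Lemma never_matching_cover (a : R) n : 1 <= a <= 2 -> never_matching a ->
  (0 < n)%N -> parameter_itv n (orbit_quotient a n) a.
Proof.
move=> a12 na n0.
have na' i : (i < n)%N -> ~ entrance_times a i by move=> _; exact: na.
have := orbit_bounds a12 na'; rewrite orbit_quotientE//.
set k := orbit_quotient a n => kb.
have p2 : 2 <= 2 ^+ n :> R.
  by rewrite -(prednK n0) exprS ler_pMr// exprn_ege1//; lra.
have kp : 2 ^+ n / 4 <= k%:R :> R by nra.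
have k0 : 0 < k%:R :> R by lra.
rewrite /parameter_itv /= in_itv /=; apply/andP; split.
  by rewrite ler_pdivrMr//; lra.
have -> : (2 ^+ n - 1) / k%:R = 2 ^+ n / k%:R - k%:R^-1 :> R by ring.
have : k%:R^-1 <= 4 / 2 ^+ n :> R.
  by rewrite ler_pdivlMr ?exprn_gt0// mulrC ler_pdivrMr//; lra.
have : a <= 2 ^+ n / k%:R by rewrite ler_pdivlMr//; lra.
lra.
Qed.

Lemma negligible_never_matching m :
  mu.-negligible [set a | [/\ 1 <= a <= 2, 1 < 2 ^+ m * (a - 1) & never_matching a]].
Proof.
(* Using [J.+1] digits keeps the number of steps positive, as [never_matching_cover] requires. *)
pose U J : set (measurableTypeR R) :=
  \big[setU/set0]_(k <- digit_numbers m J.+1) parameter_itv (J.+1 * m.+1) k.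
have mI n k : measurable (parameter_itv n k : set (measurableTypeR R)).
  exact: measurable_itv.
have mU J : measurable (U J) by apply: bigsetU_measurable => k _.
have lI n k : mu (parameter_itv n k) = (4 / 2 ^+ n)%:E.
  rewrite lebesgue_measure_itv /= lte_fin ifT; last by rewrite ltrDl divr_gt0// exprn_gt0.
  by rewrite -EFinB; congr (_%:E); ring.
(* The ratio of admissible digits to all digits; being below 1, it makes the total length of the
   cover tend to 0. *)
pose r : R := (2 ^ m.+1).-1%:R / 2 ^+ m.+1.
have lU J : (mu (U J) <= (4 * r ^+ J.+1)%:E)%E.
  apply: (@le_trans _ _ (\sum_(k <- digit_numbers m J.+1) mu (parameter_itv (J.+1 * m.+1) k))%E).
    rewrite /U; elim: (digit_numbers _ _) => [|k s IH]; first by rewrite !big_nil measure0.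
    rewrite !big_cons; apply: le_trans (measureU2 _ _ _) _ => //.
      by apply: bigsetU_measurable => ? _.
    by rewrite leeD2l.
  under eq_bigr do rewrite lI.
  rewrite sumEFin lee_fin big_const_seq count_predT size_digit_numbers iter_addr addr0.
  rewrite -[_ *+ (_ ^ _)]mulr_natl natrX /r expr_div_n -exprM mulnC.
  by rewrite le_eqVlt; apply/orP; left; apply/eqP; field; rewrite expf_neq0.
exists (\bigcap_J U J); split.
- by apply: bigcapT_measurable.
- apply/eqP; rewrite eq_le measure_ge0 andbT.
  have cv : (4 * r ^+ n.+1)%:E @[n --> \oo] --> 0%:E.
    apply/fine_cvgP; split; first by near=> n.
    rewrite [X in X @ _ --> _](_ : _ = geometric (4 * r) r).
      apply: cvg_geometric; rewrite ger0_norm ?divr_ge0 ?exprn_ge0//.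
      by rewrite ltr_pdivrMr ?exprn_gt0// mul1r -natrX ltr_nat prednK ?expn_gt0.
    by apply/funext => n; rewrite /= exprS mulrA.
  by apply: (cvge_to_ge cv); near=> J; apply: le_trans (lU J); apply: le_measure; rewrite ?inE//;
    [exact: bigcapT_measurable|exact: bigcap_inf].
move=> a [a12 am na] J _; rewrite /U -bigcup_seq.
exists (orbit_quotient a (J.+1 * m.+1)); last exact: never_matching_cover.
exact: orbit_quotient_digits.
Unshelve. all: by end_near.
Qed.

End Null.

(** * Matching one step after the entrance into the gap *)

Section Matching.
Variables (R : realType) (a : R).

Local Notation x n := (iter n (Sdoubling a) 1).

Lemma criticalN (y : R) : critical a (- y) -> critical a y.
Proof.
rewrite /critical /= !inE => /or4P[] /eqP e; apply/or4P.
- by constructor 4; apply/eqP; lra.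
- by constructor 3; apply/eqP; lra.
- by constructor 2; apply/eqP; lra.
- by constructor 1; apply/eqP; lra.
Qed.

Lemma critical_flipped flip (y : R) : ~ critical a y -> ~ critical a (flipped flip y).
Proof. by case: flip => //= nc /criticalN. Qed.

Lemma Tdoubling_flipped flip j (y : R) : 1 < a < 2 ->
  Tdoubling a j (flipped flip y) = flipped flip (Tdoubling a (flip (+) j) y).
Proof. by case: flip => //= a12; rewrite TdoublingN. Qed.

Local Notation flip c := (c \notin [:: 2^-1; (1 - a) / 2]).

(** Letters are complemented at a flipped point because reflection exchanges the two maps. The
    induction removes the last letter, which is applied last. *)
Lemma germ_orbit (c : R) left j u : 1 < a < 2 -> irrational a -> critical a c ->
  (forall i, (i < size u)%N -> ~ entrance_times a i) ->
  germ a c (side left c) (j :: u) (flipped (flip c) (orbit_state a (size u)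
    (state_run a 0 (first_state left (flip c) j) (map (addb (flip c)) u)))).
Proof.
move=> a12 irr cc; elim/last_ind: u => [_|u i IH]; first exact: germ_first.
rewrite size_rcons => nn.
have /IH {}IH : forall i, (i < size u)%N -> ~ entrance_times a i.
  by move=> k /ltnW; exact: nn.
rewrite -rcons_cons map_rcons state_run_rcons size_map add0n.
set s := state_run _ _ _ _ in IH *.
have [Ts nc] := Tdoubling_orbit_state s (flip c (+) i) a12 irr nn.
rewrite -Ts -Tdoubling_flipped//.
by apply: germ_rcons; [exact: cvg_side|exact: IH|exact: critical_flipped].
Qed.

(** One letter sets the initial state, [n] more lead to time [n], and the last is applied in the
    gap, where the state is forgotten. *)
Lemma germ_matching (c : R) left u n : 1 < a < 2 -> irrational a -> critical a c ->
  entrance_times a n -> (forall i, (i < n)%N -> ~ entrance_times a i) ->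
  size u = n.+2 -> germ a c (side left c) u (flipped (flip c) (x n.+1)).
Proof.
move=> a12 irr cc gap nn; case: u => [//|j u]; elim/last_ind: u => [//|u i _].
rewrite -rcons_cons size_rcons => -[un].
have := @germ_orbit c left j u a12 irr cc; rewrite un => /(_ nn).
set s := state_run _ _ _ _ => gs.
have [Ts nc] := Tdoubling_gap s (flip c (+) i) a12 gap.
rewrite -Ts -Tdoubling_flipped//.
by apply: germ_rcons; [exact: cvg_side|exact: gs|exact: critical_flipped].
Qed.

Lemma matching_timeE n : entrance_times a n ->
  (forall i, (i < n)%N -> ~ entrance_times a i) ->
  matching_time a = (n.+1%:R)%:E.
Proof.
move=> gap nn; rewrite /matching_time.
suff -> : ereal_inf [set m%:R%:E | m in entrance_times a] = (n%:R : R)%:E.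
  by rewrite -EFinD natr1.
apply/eqP; rewrite eq_le; apply/andP; split.
  by apply: ereal_inf_lbound; exists n.
apply: le_ereal_inf_tmp => _ [m gm <-]; rewrite lee_fin ler_nat leqNgt.
by apply/negP => /nn.
Qed.

Lemma matching_setE n (c : R) :
  matching_set a n c = [set flipped (flip c) (x n)].
Proof. by rewrite /matching_set /flipped; case: (c \in _). Qed.

(** All words of length [n.+2] have the same limit and the same derivative on both sides of [c], so
    a constant stopping time makes the two sums equal term by term. *)
Lemma strong_random_matching_doubling (p : R) n : 1 < a < 2 -> irrational a ->
  entrance_times a n -> (forall i, (i < n)%N -> ~ entrance_times a i) ->
  strong_random_matching_with (Tdoubling a) (bernoulli_weight p)
    (critical a) (fun=> n.+2) (matching_set a n.+1).
Proof.
move=> a12 irr gap nn c cc; exists (fun=> n.+2), (fun=> n.+2).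
rewrite matching_setE; set y0 := flipped _ _.
have G left u : size u = n.+2 -> germ a c (side left c) u y0.
  by move=> un; exact: germ_matching.
have GT left u : size u = n.+2 -> Tlim (Tdoubling a) u (side left c) = y0.
  by move=> un; exact: (germ_Tlim (@cvg_side R left c) (G left u un)).
have GD left u : size u = n.+2 -> dTlim (Tdoubling a) u (side left c) = 2 ^+ n.+2.
  by move=> un; rewrite (germ_dTlim (F := side left c) (@side_open _ _ _) (G left u un)) un.
have sb w : size (block w n.+2) = n.+2 by rewrite size_mkseq.
split=> //.
- split=> [_ ->|w]; last first.
    by split; rewrite /= ?leqnn//; [exact: (GT true _ (sb w))|exact: (GT false _ (sb w))].
  split; exists (fun=> true), n.+2; split; rewrite /= ?leqnn//; apply/esym.
    exact: (GT true _ (sb _)).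
  exact: (GT false _ (sb _)).
- move=> y _.
  have E left : matching_words (Tdoubling a) n.+2 (fun=> n.+2) (side left c) y =
      [set u | size u = n.+2 /\ y0 = y].
    apply/seteqP; split=> u /=.
      by case=> _ [w ->]; rewrite GT ?sb.
    move=> [un <-]; split; [by rewrite un /= leqnn|exists (nth true u)|exact: GT].
    by rewrite -un /block mkseq_nth.
  rewrite (E true) (E false); apply: eq_fsbigr => u; rewrite inE /= => -[un _].
  by rewrite (GD true)// (GD false).
Qed.

End Matching.

(** * Impossibility of earlier matching *)

Section Minimality.
Variables (R : realType) (a p : R).

(* The probability that the state is [true] after [r] further steps. *)
Fixpoint hit (r n : nat) (s : bool) : R :=
  if r is r'.+1 then
    p * hit r' n.+1 (state_step a n s false) +
    (1 - p) * hit r' n.+1 (state_step a n s true)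
  else s%:R.

(** At each step one letter keeps the two states apart and the other merges them, so the difference
    is multiplied by [p] or [1 - p]. *)
Lemma hit_lt r n : 0 < p < 1 -> hit r n false < hit r n true.
Proof.
move=> p01; elim: r n => [n|r IH n] /=; first exact: ltr01.
rewrite /state_step; have := IH n.+1; case: ifP => _ /=;
  set t := hit _ _ true; set f := hit _ _ false => ft; nra.
Qed.

Definition word_state left (u : seq bool) : bool :=
  if u is j :: u' then state_run a 0 (first_state left false j) u' else false.

(** For a word of size at most [N.+1], the probability that a random sequence starts with [u] and
    has state [true] at time [N]. *)
Definition hit_weight (N : nat) left (u : seq bool) : R :=
  if u is _ :: u' then
    pword (bernoulli_weight p) u * hit (N - size u') (size u') (word_state left u)
  else p * hit N 0 (first_state left false false) +
       (1 - p) * hit N 0 (first_state left false true).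

Lemma pword_rcons (q : bool -> R) u j : pword q (rcons u j) = pword q u * q j.
Proof. by rewrite /pword -cats1 big_cat big_seq1. Qed.

Lemma hit_weight_additive N left u : (size u <= N)%N ->
  hit_weight N left u =
    hit_weight N left (rcons u true) + hit_weight N left (rcons u false).
Proof.
case: u => [_|j u] /=.
  by rewrite /pword !big_seq1 subn0 /=; ring.
move=> uN; rewrite -!rcons_cons !pword_rcons !size_rcons !state_run_rcons !add0n.
by rewrite -(subnSK uN) /=; ring.
Qed.

Lemma notin_half : ((2^-1 : R) \notin [:: 2^-1; (1 - a) / 2]) = false.
Proof. by rewrite inE eqxx. Qed.

Lemma germ_half left u n : 1 < a < 2 -> irrational a ->
  (forall i, (i < n)%N -> ~ entrance_times a i) -> (0 < size u <= n.+1)%N ->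
  germ a 2^-1 (side left 2^-1) u (orbit_state a (size u).-1 (word_state left u)).
Proof.
case: u => [//|j u] a12 irr nn /= un.
have := @germ_orbit _ a 2^-1 left j u a12 irr; rewrite notin_half /=.
have -> : map (addb false) u = u by rewrite (eq_map (g := id)) ?map_id.
apply; first by rewrite /critical /= !inE eqxx !orbT.
by move=> i iu; apply: nn; exact: leq_trans iu (un : (size u <= n)%N).
Qed.

(** Optional stopping, with the stopped words grouped by their endpoint. The endpoint determines
    length and state, so each group contributes its matching sum times a factor that depends neither
    on the side nor on [t]; the power of 2 undoes the derivative. *)
Lemma sum_hit_weight N K left (Y : set R) (t : (nat -> bool) -> nat) :
  1 < a < 2 -> irrational a ->
  (forall i, (i < N)%N -> ~ entrance_times a i) -> (K <= N)%N ->
  block_determined t ->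
  (forall w, (0 < t w <= K.+1)%N /\
     Y (Tlim (Tdoubling a) (block w (t w)) (side left 2^-1))) ->
  hit_weight N left [::] =
  \sum_(i : 'I_K.+1 * bool | `[< Y (orbit_state a i.1 i.2) >])
    2 ^+ i.1.+1 * hit (N - i.1) i.1 i.2 *
    \sum_(u \in matching_words (Tdoubling a) K.+1 t (side left 2^-1)
            (orbit_state a i.1 i.2))
      (pword (bernoulli_weight p) u / dTlim (Tdoubling a) u (side left 2^-1)).
Proof.
move=> a12 irr nn KN tP tY.
have tK w : (t w <= K.+1)%N by case: (tY w) => /andP[].
rewrite -(sum_stopped_words tP tK); last first.
  by move=> u; rewrite ltnS => uK; exact: hit_weight_additive (leq_trans uK KN).
pose key u : 'I_K.+1 * bool := (inord (size u).-1, word_state left u).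
have st u : stopped_word t u -> [/\ (0 < size u <= K.+1)%N,
    Tlim (Tdoubling a) u (side left 2^-1) = orbit_state a (key u).1 (key u).2,
    dTlim (Tdoubling a) u (side left 2^-1) = 2 ^+ size u &
    Y (orbit_state a (key u).1 (key u).2)].
  move=> /asboolP[w uE]; have [uK Yu] := tY w; rewrite -uE in Yu.
  have sz : (0 < size u <= K.+1)%N by rewrite uE size_mkseq.
  have szN : (0 < size u <= N.+1)%N.
    by move: sz => /andP[-> /leq_trans]; apply.
  have g := germ_half left a12 irr nn szN.
  have e : nat_of_ord (key u).1 = (size u).-1.
    by rewrite inordK//; case/andP: sz => /prednK -> .
  rewrite e; split=> //; first exact: (germ_Tlim (@cvg_side R left 2^-1) g).
    exact: (germ_dTlim (F := side left 2^-1) (@side_open _ _ _) g).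
  by rewrite -(germ_Tlim (@cvg_side R left 2^-1) g).
move: (words_upto K.+1) (mem_words_upto K.+1) (words_upto_uniq K.+1) => W mW Wuniq.
rewrite (partition_big key (fun i => `[< Y (orbit_state a i.1 i.2) >])); last first.
  by move=> u /st[_ _ _ Yu]; exact/asboolP.
apply: eq_bigr => -[n s] /asboolP Yi.
(* By [orbit_state_inj], reaching this point means stopping at exactly this time in this state. *)
have -> : matching_words (Tdoubling a) K.+1 t (side left 2^-1) (orbit_state a n s) =
    [set` [seq u <- W | stopped_word t u & key u == (n, s)]].
  apply/seteqP; split=> u /=; rewrite mem_filter mW.
    move=> [/andP[u0 uK] uw uE].
    have us : stopped_word t u by apply/asboolP.
    rewrite uK us andbT /=; apply/eqP; have [_ e _ _] := st _ us.
    have na (m : 'I_K.+1) : forall i, (i < m)%N -> ~ entrance_times a i.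
      by move=> i im; apply: nn; apply: leq_trans im (leq_trans _ KN); rewrite -ltnS.
    move: e; rewrite uE => /esym /orbit_state_inj.
    have a12' : 1 <= a <= 2 by lra.
    move=> /(_ a12' irr (na _) (na _)) [e1 e2].
    by rewrite [key u]surjective_pairing e2; congr (_, _); exact: val_inj.
  move=> /andP[/andP[us /eqP ku] uK]; have [/andP[u0 _] e _ _] := st _ us.
  by split; [rewrite u0|exact/asboolP|rewrite e ku].
rewrite -fsbig_seq ?filter_uniq// big_filter mulr_sumr.
apply: eq_bigr => u /andP[us /eqP ku].
have [/andP[u0 uK] _ -> _] := st _ us.
have -> : s = word_state left u by rewrite -[s]/((n, s).2) -ku.
have -> : nat_of_ord n = (size u).-1.
  by rewrite -[n]/((n, s).1) -ku /= inordK// prednK.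
case: u u0 {us ku uK} => [//|j u] _; rewrite /hit_weight [(size _).-1]/=.
by rewrite [size (j :: u)]/=; field; rewrite expf_neq0.
Qed.

(** Equal matching sums at 1/2 would give equal total weights on the two sides, but these differ by
    [p * (hit N 0 true - hit N 0 false)], which is positive by [hit_lt]. *)
Lemma strong_random_matching_half_late N K (Y : R -> set R) : 0 < p < 1 ->
  1 < a < 2 -> irrational a -> (forall i, (i < N)%N -> ~ entrance_times a i) ->
  (K <= N)%N ->
  ~ strong_random_matching_with (Tdoubling a) (bernoulli_weight p)
      (critical a) (fun=> K.+1) Y.
Proof.
move=> p01 a12 irr nn KN.
have ch : critical a 2^-1 by rewrite /critical /= !inE eqxx !orbT.
move=> /(_ _ ch)[k [l [[_ YY] kP lP sums]]].
have H1 := @sum_hit_weight N K true (Y 2^-1) k a12 irr nn KN kP.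
have H2 := @sum_hit_weight N K false (Y 2^-1) l a12 irr nn KN lP.
have : hit_weight N true [::] = hit_weight N false [::].
  rewrite {}H1 1?{}H2; [|by move=> w; case: (YY w)..].
  by apply: eq_bigr => i /asboolP/sums ->.
have := @hit_lt N 0 p01; rewrite /hit_weight /first_state /=.
by set f := hit _ _ false; set t := hit _ _ true; nra.
Qed.

End Minimality.

(** * The exceptional null set and the conclusion *)

Lemma negligible_bad_parameters (R : realType) :
  (@lebesgue_measure R).-negligible
    [set a | 1 <= a <= 2 /\ (rational a \/ never_matching a)].
Proof.
have Q0 : (@lebesgue_measure R).-negligible (@rational R).
  apply/negligibleP; last exact: lebesgue_measure_rat.
  rewrite (_ : rational = \bigcup_(q : rat) [set ratr q]).
    by apply: bigcupT_measurable_rat => q; exact: measurable_set1.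
  by apply/seteqP; split=> [_ [q _ <-]|_ [q _ ->]]; exists q.
have := negligible_bigcup (@negligible_never_matching R) => N0.
apply: negligibleS (negligibleU Q0 N0) => a /= [a12 [Qa|na]]; first by left.
(* At [a = 1] no [m] satisfies [1 < 2 ^+ m * (a - 1)], but this parameter is rational. *)
have [a1|a1] := eqVneq a 1.
  by left; rewrite a1; exists 1 => //; rewrite rmorph1.
right; have a10 : 0 < a - 1 by rewrite subr_gt0 lt_neqAle eq_sym a1; case/andP: a12.
exists (Num.bound (a - 1)^-1) => //; split=> //.
rewrite -ltr_pdivrMr// mul1r.
apply: lt_le_trans (archi_boundP _) _; first by rewrite invr_ge0 ltW.
by rewrite -natrX ler_nat ltnW// ltn_expl.
Qed.

Theorem theorem3p5 (R : realType) (p : R) (hp : 0 < p < 1) :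
  {ae (@lebesgue_measure R), forall a : R, 1 <= a <= 2 ->
    exists M : nat,
      [/\ matching_time a = (M%:R)%:E,
          strong_random_matching_with (Tdoubling a) (bernoulli_weight p)
            (critical a) (fun=> M.+1) (matching_set a M) &
          forall K : nat, (0 < K < M.+1)%N ->
            ~ exists Y : R -> set R,
                strong_random_matching_with (Tdoubling a) (bernoulli_weight p)
                  (critical a) (fun=> K) Y]}.
Proof.
apply: negligibleS (@negligible_bad_parameters R) => a; apply: contra_notP.
move=> bad a12.
have irr : irrational a by move=> Qa; apply: bad; split=> //; left.
have /existsNP[m0 /contrapT gap0] : ~ never_matching a.
  by move=> na; apply: bad; split=> //; right.
have a12' : 1 < a < 2.
  have a1 : a != 1 by apply/eqP => a1; apply: irr; exists 1 => //; rewrite a1 rmorph1.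
  have a2 : a != 2 by apply/eqP => a2; apply: irr; exists 2 => //; rewrite a2 ratr_nat.
  by case/andP: a12 => b1 b2; rewrite !lt_neqAle b1 b2 eq_sym a1 a2.
have ex : exists n, `[< entrance_times a n >] by exists m0; apply/asboolP.
case: (ex_minnP ex) => n /asboolP gap min.
have nn i : (i < n)%N -> ~ entrance_times a i.
  by move=> + /asboolP/min; rewrite ltnNge => /negP.
exists n.+1; split; first exact: matching_timeE.
  exact: strong_random_matching_doubling.
(* From here [K] is the predecessor of the proposed bound, so [K.+1 < n.+2] becomes [K <= n]. *)
move=> [//|K] /andP[_]; rewrite 2!ltnS => Kn [Y].
exact: (@strong_random_matching_half_late _ _ _ n).
Qed.
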